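(* Let $m$ be any positive integer and let $F = P_3 \sqcup mK_1$. Then $D[F] = v(F) - 1$.
   Context: All graphs are finite simple graphs. Consider first-order logic over graphs whose signature consists of two binary predicate symbols: $\sim$ (adjacency) and $=$ (equality). For a graph $F$, let $\mathcal{C}[F]$ be the property (class of graphs) of containing an induced subgraph isomorphic to $F$. A sentence $\varphi$ expresses $\mathcal{C}[F]$ if for every graph $G$: $G \models \varphi \iff G \in \mathcal{C}[F]$. $D[F]$ denotes the minimal quantifier depth (maximal length of a chain of nested quantifiers) of a first-order sentence expressing $\mathcal{C}[F]$. $v(F)$ is the number of vertices of $F$. $P_3$ is the path on $3$ vertices, $K_1$ is the one-vertex graph, $A \sqcup B$ denotes disjoint union, and $mA$ denotes the disjoint union of $m$ copies of $A$. *)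

(* Defs.v *)
From HB Require Import structures.
From mathcomp Require Import all_boot.

Set Implicit Arguments.
Unset Strict Implicit.
Unset Printing Implicit Defensive.

Record sgraph := SGraph {
  vertex :> finType;
  adj : rel vertex;
  adj_sym : symmetric adj;
  adj_irrefl : irreflexive adj }.

Definition isomorphic (G H : sgraph) : Prop :=
  exists2 f : G -> H, bijective f & {mono f : x y / adj x y}.

Section Induced.
Variables (G : sgraph) (S : {set G}).

Definition induced_adj : rel {x : G | x \in S} :=
  fun x y => adj (val x) (val y).

Lemma induced_adj_sym : symmetric induced_adj.
Proof. by move=> x y; apply: adj_sym. Qed.

Lemma induced_adj_irrefl : irreflexive induced_adj.
Proof. by move=> x; apply: adj_irrefl. Qed.

Definition induced : sgraph := SGraph induced_adj_sym induced_adj_irrefl.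
End Induced.

Definition contains_induced (F G : sgraph) : Prop :=
  exists S : {set G}, isomorphic (induced S) F.

Section DisjointUnion.
Variables G H : sgraph.

Definition sum_adj : rel (G + H)%type := fun u v =>
  match u, v with
  | inl x, inl y => adj x y
  | inr x, inr y => adj x y
  | _, _ => false
  end.

Lemma sum_adj_sym : symmetric sum_adj.
Proof. by move=> [x|x] [y|y] //=; apply: adj_sym. Qed.

Lemma sum_adj_irrefl : irreflexive sum_adj.
Proof. by move=> [x|x] /=; apply: adj_irrefl. Qed.

Definition dunion : sgraph := SGraph sum_adj_sym sum_adj_irrefl.
End DisjointUnion.

Section Copies.
Variables (m : nat) (G : sgraph).

Definition copies_adj : rel ('I_m * G)%type :=
  fun u v => (u.1 == v.1) && adj u.2 v.2.

Lemma copies_adj_sym : symmetric copies_adj.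
Proof. by move=> u v; rewrite /copies_adj eq_sym adj_sym. Qed.

Lemma copies_adj_irrefl : irreflexive copies_adj.
Proof. by move=> u; rewrite /copies_adj adj_irrefl andbF. Qed.

Definition copies : sgraph := SGraph copies_adj_sym copies_adj_irrefl.
End Copies.

Section PathComplete.
Variable n : nat.

Definition path_adj : rel 'I_n :=
  fun i j => (i.+1 == j :> nat) || (j.+1 == i :> nat).

Lemma path_adj_sym : symmetric path_adj.
Proof. by move=> i j; rewrite /path_adj orbC. Qed.

Lemma path_adj_irrefl : irreflexive path_adj.
Proof. by move=> i; rewrite /path_adj orbb gtn_eqF. Qed.

Definition path_graph : sgraph := SGraph path_adj_sym path_adj_irrefl.

Definition complete_adj : rel 'I_n := fun i j => i != j.

Lemma complete_adj_sym : symmetric complete_adj.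
Proof. by move=> i j; rewrite /complete_adj eq_sym. Qed.

Lemma complete_adj_irrefl : irreflexive complete_adj.
Proof. by move=> i; rewrite /complete_adj eqxx. Qed.

Definition complete_graph : sgraph :=
  SGraph complete_adj_sym complete_adj_irrefl.
End PathComplete.

(* Well-scoped de Bruijn syntax: the free variables of a [formula n] are      *)
(* indexed by 'I_n, and variable 0 is bound by the innermost quantifier.      *)
Inductive formula : nat -> Type :=
  | FEq n (i j : 'I_n) : formula n
  | FAdj n (i j : 'I_n) : formula n
  | FNot n (p : formula n) : formula n
  | FAnd n (p q : formula n) : formula n
  | FOr n (p q : formula n) : formula n
  | FImp n (p q : formula n) : formula n
  | FExists n (p : formula n.+1) : formula n
  | FForall n (p : formula n.+1) : formula n.

Definition sentence := formula 0.

Fixpoint qdepth n (p : formula n) : nat :=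
  match p with
  | FEq _ _ _ | FAdj _ _ _ => 0
  | FNot _ p => qdepth p
  | FAnd _ p q | FOr _ p q | FImp _ p q => maxn (qdepth p) (qdepth q)
  | FExists _ p | FForall _ p => (qdepth p).+1
  end.

Fixpoint sat (G : sgraph) n (p : formula n) : n.-tuple G -> Prop :=
  match p in formula n return n.-tuple G -> Prop with
  | FEq _ i j => fun e => tnth e i = tnth e j
  | FAdj _ i j => fun e => adj (tnth e i) (tnth e j)
  | FNot _ p => fun e => ~ sat p e
  | FAnd _ p q => fun e => sat p e /\ sat q e
  | FOr _ p q => fun e => sat p e \/ sat q e
  | FImp _ p q => fun e => sat p e -> sat q e
  | FExists _ p => fun e => exists x : G, sat p [tuple of x :: e]
  | FForall _ p => fun e => forall x : G, sat p [tuple of x :: e]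
  end.

Definition models (G : sgraph) (phi : sentence) : Prop := sat phi [tuple of [::] : seq G].

Definition expresses (phi : sentence) (C : sgraph -> Prop) : Prop :=
  forall G : sgraph, models G phi <-> C G.

(* [is_D F d] says D[F] = d: the minimum of the quantifier depths of the      *)
(* sentences expressing C[F] exists (is attained) and equals d.               *)
Definition is_D (F : sgraph) (d : nat) : Prop :=
  (exists2 phi : sentence,
     expresses phi (contains_induced F) & qdepth phi = d) /\
  (forall phi : sentence,
     expresses phi (contains_induced F) -> d <= qdepth phi).

(* Main.v *)
Require Import Defs.
From mathcomp Require Import all_boot zify.

(* Upper bound.  The complement of P_3 + m K_1 is the join of K_(m-1) with the
   paw (a triangle with a pendant edge).  A graph contains an induced paw iff
   some vertex x of a triangle has a non-neighbour y that shares a neighbour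
   with x without being a twin of x, and this takes only three nested
   quantifiers for a four-vertex pattern.  Relativizing it to the common
   non-neighbours of m - 1 independent vertices gives quantifier depth m + 2.

   Lower bound.  For N large, K_(N,N) + m K_N contains P_3 + m K_1 while
   K_(N,N) + (m-1) K_N does not.  Spoiler needs m rounds to run the smaller graph
   out of cliques; Duplicator then answers inside K_(N,N), on the side of the
   vertices already chosen there, and exposing this takes a round more than the
   m + 1 available. *)

Set Implicit Arguments.
Unset Strict Implicit.
Unset Printing Implicit Defensive.

(** * Induced copies and adjacency in the complement *)

Lemma contains_inducedP (F G : sgraph) :
  contains_induced F G <->
  exists2 f : F -> G, injective f & {mono f : x y / adj x y}.
Proof.
split=> [[S [g [h gK hK] gM]]|[f fI fM]].
  exists (fun v => val (h v)); first exact: inj_comp val_inj (can_inj hK).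
  by move=> x y; rewrite -{2}(hK x) -{2}(hK y) gM.
pose S := f @: [set: F].
have fS v : f v \in S by rewrite imset_f.
pose h v : induced S := exist _ (f v) (fS v).
have hI : injective h by move=> x y /(congr1 val) /fI.
have [|g hK gK] := inj_card_bij hI.
  by rewrite card_sig /S card_imset // cardsT.
by exists S; exists g => [|x y]; [exists h | rewrite -{2}(gK x) -{2}(gK y) -fM].
Qed.

Definition coadj (G : sgraph) : rel G := fun x y => (x != y) && ~~ adj x y.

Lemma coadjC (G : sgraph) : symmetric (@coadj G).
Proof. by move=> x y; rewrite /coadj eq_sym adj_sym. Qed.

Lemma coadjxx (G : sgraph) (x : G) : coadj x x = false.
Proof. by rewrite /coadj eqxx. Qed.

(** Injectivity comes for free: [adj] and [coadj] are both irreflexive, so distinct vertices cannot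
    share an image. *)
Lemma contains_induced_of_map (F G : sgraph) (f : F -> G) :
  (forall u v, u != v -> if adj u v then adj (f u) (f v) else coadj (f u) (f v)) ->
  contains_induced F G.
Proof.
move=> fP; apply/contains_inducedP.
have fI : injective f.
  move=> u v fuv; apply/eqP/negPn/negP => /fP.
  by rewrite fuv adj_irrefl coadjxx if_same.
exists f => // u v; have [-> | /fP] := eqVneq u v; first by rewrite !adj_irrefl.
by case: (adj u v) => [-> | /andP[_ /negPf]].
Qed.

(** * Expressing the property *)

(* In the complement of the graph this is an induced paw, that is, a triangle
   [a b c] with the pendant edge [a d]; the vertices are automatically
   distinct. *)
Definition has_copaw (G : sgraph) (U : {pred G}) : Prop :=
  exists a b c d, [/\ a \in U, b \in U, c \in U & d \in U] /\
    [/\ coadj a b, coadj a c, coadj b c, coadj a d &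
        ~~ coadj b d /\ ~~ coadj c d].

(** The nesting keeps the depth at three: below [x], the triangle [x t1 t2] and the vertex [y] are
    separate branches, as are [z] and [w] below [y]. The case [y = x] is not ruled out by
    [~ coadj x y], but then no [w] exists. *)
Definition has_nontwins (G : sgraph) (U : {pred G}) : Prop :=
  exists x, x \in U /\
    ((exists t1, t1 \in U /\ coadj x t1 /\
       exists t2, t2 \in U /\ coadj x t2 /\ coadj t1 t2) /\
     (exists y, y \in U /\ ~ coadj x y /\
       (exists z, z \in U /\ coadj z x /\ coadj z y) /\
       (exists w, w \in U /\ ~ (coadj w x <-> coadj w y)))).

(** In the complement, [x z t] and [y z t] are triangles. If [w] is adjacent to [z] or [t], it forms
    a triangle with that vertex and [x], to which [y] is pendant; otherwise [w] is pendant to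
    [x z t]. *)
Lemma common_edge_copaw (G : sgraph) (U : {pred G}) (x y z t w : G) :
  x \in U -> y \in U -> z \in U -> t \in U -> w \in U ->
  coadj z x -> coadj x t -> coadj z t -> coadj z y -> coadj y t ->
  ~~ coadj x y -> coadj w x -> ~~ coadj w y -> has_copaw U.
Proof.
move=> xU yU zU tU wU zx xt zt zy yt xy wx wy.
case wz : (coadj w z).
  by exists z, w, x, y; do !split=> //; rewrite coadjC.
case wt : (coadj w t).
  by exists t, w, x, y; do !split=> //; rewrite coadjC.
by exists x, z, t, w; do !split=> //; rewrite coadjC // (wz, wt).
Qed.

(* In a connected graph without an induced paw, a triangle forces the graph to
   be complete multipartite, hence non-adjacent vertices to be twins. *)
Lemma has_copawP (G : sgraph) (U : {pred G}) : has_copaw U <-> has_nontwins U.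
Proof.
split=> [[a [b [c [d [[aU bU cU dU] [ab ac bc ad [bd cd]]]]]]]|].
  exists b; split=> //; split.
    by exists a; rewrite coadjC; do 2!split=> //; exists c.
  exists d; split=> //; split; first exact/negP.
  split; first by exists a.
  by exists c; split=> //; rewrite (coadjC c) bc (negPf cd) => -[/(_ isT)].
move=> [x [xU [[t1 [t1U [xt1 [t2 [t2U [xt2 t12]]]]]]
  [y [yU [/negP xy [[z [zU [zx zy]]] [w [wU wxy]]]]]]]]].
(* If [z] is co-adjacent to neither [t1] nor [t2], it is pendant to the triangle [x t1 t2] of the
   complement. *)
have [//|[t [tU xt zt]]] :
    has_copaw U \/ exists t, [/\ t \in U, coadj x t & coadj z t].
  case zt1 : (coadj z t1); first by right; exists t1.
  case zt2 : (coadj z t2); first by right; exists t2.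
  left; exists x, t1, t2, z; do !split=> //; rewrite coadjC //.
    by rewrite zt1.
  by rewrite zt2.
(* If [y] is not co-adjacent to [t], it is pendant at [z] to the triangle [x z t]. *)
case yt : (coadj y t); last first.
  exists z, x, t, y; do !split=> //; first by rewrite coadjC yt.
have [wx|wx] := boolP (coadj w x).
  have [wy|wy] := boolP (coadj w y); first by case: wxy.
  exact: (common_edge_copaw xU yU zU tU wU).
have [wy|wy] := boolP (coadj w y); last by case: wxy; rewrite (negPf wx) (negPf wy).
by apply: (common_edge_copaw yU xU zU tU wU); rewrite // coadjC.
Qed.

Definition conbrs (G : sgraph) (e : seq G) : {pred G} :=
  [pred v | all (coadj v) e].

Fixpoint extends_to_nontwins k (G : sgraph) (e : seq G) : Prop :=
  if k is k'.+1 then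
    exists x, x \in conbrs e /\ extends_to_nontwins k' (x :: e)
  else has_nontwins (conbrs e).

Lemma extends_to_nontwinsP k (G : sgraph) (e : seq G) :
  pairwise (@coadj G) e ->
  extends_to_nontwins k e <->
  exists s, [/\ size s = k, pairwise (@coadj G) (s ++ e) &
                has_copaw (conbrs (s ++ e))].
Proof.
elim: k e => [|k IHk] e e_ind /=.
  rewrite -has_copawP; split=> [|[s [/size0nil -> _]] //]; by exists [::].
split=> [[x [xe]]|[s [/eqP ss s_ind sP]]].
  rewrite IHk /= ?e_ind ?andbT // => -[s [<- s_ind sP]].
  by exists (rcons s x); rewrite size_rcons cat_rcons.
(* The vertex chosen first is the last entry of [s]. *)
case/lastP: s ss s_ind sP => // s x; rewrite size_rcons cat_rcons => /eqP[ss] s_ind.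
have x_ind: pairwise (@coadj G) (x :: e).
  by move: s_ind; rewrite pairwise_cat => /and3P[].
exists x; split; first by case/andP: x_ind.
by apply/IHk => //; exists s.
Qed.

Definition path3_isolated m := dunion (path_graph 3) (copies m (complete_graph 1)).

(** The copaw uses up one isolated vertex: [a] is co-adjacent to [b], [c] and [d], while [b], [d],
    [c] form the path. This leaves [m] isolated vertices for the independent set. *)
Lemma contains_path3_isolatedP m (G : sgraph) :
  contains_induced (path3_isolated m.+1) G <->
  extends_to_nontwins m ([::] : seq G).
Proof.
rewrite extends_to_nontwinsP //; split.
  move=> /contains_inducedP[f fI fM].
  have fC u v : u != v -> ~~ adj u v -> coadj (f u) (f v).
    by rewrite /coadj fM (inj_eq fI) => -> ->.
  pose p (i : 'I_3) : path3_isolated m.+1 := inl i.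
  pose q (i : 'I_m.+1) : path3_isolated m.+1 := inr (i, ord0).
  pose s := [seq f (q (lift ord0 i)) | i <- enum 'I_m].
  have qC i j : i != j -> coadj (f (q i)) (f (q j)).
    move=> ij; apply: fC; last by rewrite /= /copies_adj /= (negPf ij).
    by apply: contraNneq ij => -[->].
  have pq i j : coadj (f (p i)) (f (q j)) by exact: fC.
  have ps i : f (p i) \in conbrs s by rewrite inE all_map; apply/allP => j _ /=.
  exists s; rewrite cats0; split; first by rewrite size_map size_enum_ord.
    rewrite pairwise_map.
    apply: sub_pairwise (_ : pairwise (fun i j => i != j) _); last first.
      by rewrite -uniq_pairwise enum_uniq.
    by move=> i j ij; apply: qC; rewrite (inj_eq lift_inj).
  exists (f (q ord0)), (f (p (inord 0))), (f (p (inord 2))), (f (p (inord 1))).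
  split; split=> //.
  - by rewrite inE all_map; apply/allP => j _ /=; apply: qC.
  - by rewrite coadjC.
  - by rewrite coadjC.
  - by apply: fC; rewrite /= ?/path_adj ?inordK //; apply/eqP => -[/(congr1 val)];
      rewrite /= !inordK.
  - by rewrite coadjC.
  - by split; rewrite /coadj fM /= /path_adj !inordK // andbF.
move=> [s]; rewrite cats0 => -[ss s_ind [a [b [c [d [[aU bU cU dU]
  [ab ac bc ad [bd cd]]]]]]]].
(* [~~ coadj b d] alone would allow [b = d]; this is excluded since [c] is co-adjacent to [b] but
   not to [d]. *)
have adjbd : adj b d.
  move: bd; rewrite /coadj negb_and !negbK => /orP[/eqP bd|//].
  by move: cd; rewrite -bd coadjC bc.
have adjcd : adj c d.
  move: cd; rewrite /coadj negb_and !negbK => /orP[/eqP cd|//].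
  by move: bd; rewrite -cd bc.
pose f (v : path3_isolated m.+1) : G :=
  match v with
  | inl i => nth a [:: b; d; c] i
  | inr ij => nth a (a :: s) ij.1
  end.
have as_ind : pairwise (@coadj G) (a :: s) by rewrite /= s_ind andbT.
have pq (i : 'I_3) (j : 'I_m.+1) : coadj (nth a [:: b; d; c] i) (nth a (a :: s) j).
  have : nth a (a :: s) j \in a :: s by rewrite mem_nth //= ss.
  have bA : all (coadj b) (a :: s) by rewrite /= coadjC ab.
  have cA : all (coadj c) (a :: s) by rewrite /= coadjC ac.
  have dA : all (coadj d) (a :: s) by rewrite /= coadjC ad.
  by case: i => [[|[|[|//]]] /= _]; move: (nth _ _ _); apply/allP.
apply: (@contains_induced_of_map _ _ f) => -[i|[i i0]] [j|[j j0]] uv.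
- have {}uv : i != j by apply: contraNneq uv => ->.
  case: i j uv => [[|[|[|//]]] /= hi] [[|[|[|//]]] /= hj] //= _;
  by rewrite ?[adj d _]adj_sym ?[coadj c b]coadjC.
- exact: pq.
- by rewrite coadjC; apply: pq.
have {}uv : i != j.
  by apply: contraNneq uv => ->; rewrite (ord1 i0) (ord1 j0).
rewrite {1}/adj /= /copies_adj /= (negPf uv) /=.
have /pairwiseP-/(_ a) H := as_ind.
rewrite neq_ltn in uv; case/orP: uv => uv; last rewrite coadjC;
  by apply: H; rewrite ?inE /= ?ss.
Qed.

(** * Definability within a given quantifier depth *)

Definition definable d n (P : forall G : sgraph, seq G -> Prop) : Prop :=
  exists2 phi : formula n, qdepth phi <= d &
    forall (G : sgraph) (e : n.-tuple G), sat phi e <-> P G e.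

Section Definable.
Implicit Types P Q : forall G : sgraph, seq G -> Prop.

Lemma definable_ext d n P Q :
  (forall (G : sgraph) (e : seq G), size e = n -> P G e <-> Q G e) ->
  definable d n P -> definable d n Q.
Proof.
move=> PQ [phi dphi phiP]; exists phi => // G e.
by rewrite phiP PQ // size_tuple.
Qed.

Lemma definable_and d n P Q : definable d n P -> definable d n Q ->
  definable d n (fun G e => P G e /\ Q G e).
Proof.
move=> [p dp pP] [q dq qQ]; exists (FAnd p q) => [|G e] /=.
  by rewrite geq_max dp dq.
by rewrite pP qQ.
Qed.

Lemma definable_not d n P : definable d n P ->
  definable d n (fun G e => ~ P G e).
Proof. by move=> [p dp pP]; exists (FNot p) => //= G e; rewrite pP. Qed.

Lemma definable_iff d n P Q : definable d n P -> definable d n Q ->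
  definable d n (fun G e => P G e <-> Q G e).
Proof.
move=> [p dp pP] [q dq qQ]; exists (FAnd (FImp p q) (FImp q p)) => [|G e] /=.
  by rewrite !geq_max dp dq.
by rewrite pP qQ.
Qed.

Lemma definable_exists d n P : definable d n.+1 P ->
  definable d.+1 n (fun G e => exists x, P G (x :: e)).
Proof.
by move=> [p dp pP]; exists (FExists p) => //= G e;
  split=> -[x xP]; exists x; apply/pP.
Qed.

Lemma definable_forall_in d n (s : seq 'I_n.+1)
    (P : 'I_n.+1 -> forall G : sgraph, seq G -> Prop) :
  (forall i, definable d n.+1 (P i)) ->
  definable d n.+1 (fun G e => forall i, i \in s -> P i G e).
Proof.
move=> dP; elim: s => [|i s IHs].
  (* The syntax has no truth constant; [FEq ord0 ord0] serves as the empty conjunction, hence the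
     scope [n.+1]. *)
  by exists (FEq ord0 ord0) => // G e; split.
apply: definable_ext (definable_and (dP i) IHs) => G e _.
split=> [[iP sP] j|H]; first by rewrite inE => /predU1P[->|/sP].
by split=> [|j js]; apply: H; rewrite inE ?eqxx ?js ?orbT.
Qed.

Definition coadj_at i j (G : sgraph) (e : seq G) : Prop :=
  match onth e i, onth e j with
  | Some x, Some y => coadj x y
  | _, _ => False
  end.

Lemma definable_coadj d n i j :
  i < n -> j < n -> definable d n (@coadj_at i j).
Proof.
move=> ni nj; pose i' := Ordinal ni; pose j' := Ordinal nj.
exists (FAnd (FNot (FEq i' j')) (FNot (FAdj i' j'))) => //= G e.
have Ee k (nk : k < n) : onth e k = Some (tnth e (Ordinal nk)).
  set x := tnth e _; rewrite onthE (nth_map x) ?size_tuple //.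
  by rewrite [in RHS]/x (tnth_nth x).
rewrite /coadj_at (Ee _ ni) (Ee _ nj).
split=> [[/eqP neq /negP nadj]|/andP[/eqP neq /negP nadj]] //.
by rewrite /coadj neq.
Qed.

(** The head is the variable bound last. [drop k] skips the pattern vertices bound just before it,
    so that the relativization concerns the parameters alone. *)
Definition head_conbr k (G : sgraph) (e : seq G) : Prop :=
  if e is x :: e' then x \in conbrs (drop k e') else False.

Lemma definable_head_conbr d n k : definable d n.+1 (@head_conbr k).
Proof.
have D := @definable_forall_in d n [seq i : 'I_n.+1 <- enum 'I_n.+1 | k < i]
  (fun i => @coadj_at 0 i) (fun i => definable_coadj d (ltn0Sn n) (ltn_ord i)).
apply: definable_ext D => G [//|x e] [se].
have Ee i : i < n -> onth e i = Some (nth x e i).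
  by move=> ilt; rewrite onthE (nth_map x) ?se.
rewrite /coadj_at /head_conbr /=; split=> [H|/(all_nthP x) H i].
  apply/(all_nthP x) => i; rewrite size_drop => ilt.
  have lt : (k + i).+1 < n.+1 by lia.
  have := H (Ordinal lt); rewrite mem_filter mem_enum /= ltnS leq_addr nth_drop.
  by rewrite Ee // => /(_ isT).
rewrite mem_filter => /andP[]; case: i => [[//|i] /= lt] ki _.
have := H (i - k); rewrite size_drop nth_drop subnKC // Ee //; apply.
by rewrite se; lia.
Qed.

Lemma definable_nontwins n :
  definable 3 n (fun G e => has_nontwins (conbrs e)).
Proof.
have U d p k : definable d p.+1 (@head_conbr k) by exact: definable_head_conbr.
have C d p i j : i < p.+1 -> j < p.+1 -> definable d p.+1 (@coadj_at i j).
  exact: definable_coadj.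
(* De Bruijn positions: under three quantifiers 2 is [x], 1 is [t1] or [y], and 0 is [t2], [z] or
   [w]; under two, 1 is [x] and 0 is [t1] or [y]. *)
have T2 := definable_exists (definable_and (U 0 n.+2 2) (definable_and
  (C 0 n.+2 2 0 isT isT) (C 0 n.+2 1 0 isT isT))).
have T := definable_exists (definable_and (U 1 n.+1 1)
  (definable_and (C 1 n.+1 1 0 isT isT) T2)).
have Z := definable_exists (definable_and (U 0 n.+2 2) (definable_and
  (C 0 n.+2 0 2 isT isT) (C 0 n.+2 0 1 isT isT))).
have W := definable_exists (definable_and (U 0 n.+2 2) (definable_not
  (definable_iff (C 0 n.+2 0 2 isT isT) (C 0 n.+2 0 1 isT isT)))).
have Y := definable_exists (definable_and (U 1 n.+1 1) (definable_and
  (definable_not (C 1 n.+1 1 0 isT isT)) (definable_and Z W))).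
apply: definable_ext (definable_exists (definable_and (U 2 n 0)
  (definable_and T Y))) => G e _.
by rewrite /head_conbr /= !drop0.
Qed.

Lemma definable_extends_to_nontwins k n :
  definable (k + 3) n (extends_to_nontwins k).
Proof.
elim: k n => [|k IHk] n; first exact: definable_nontwins.
apply: definable_ext
  (definable_exists (definable_and (definable_head_conbr _ n 0) (IHk n.+1))) => G e _.
by rewrite /head_conbr /=; split=> -[x]; rewrite ?drop0 => xP; exists x; rewrite ?drop0.
Qed.

End Definable.

(** * Ehrenfeucht-Fraisse games *)

Section Game.
Variables G H : sgraph.
Implicit Types zs : seq (G * H).

Definition partial_iso zs : Prop := forall p q, p \in zs -> q \in zs ->
  (p.1 == q.1) = (p.2 == q.2) /\ adj p.1 q.1 = adj p.2 q.2.

(* [R k zs] is to be read as: Duplicator wins [k] more rounds from [zs]. *)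
Definition back_and_forth (R : nat -> seq (G * H) -> Prop) : Prop :=
  forall k zs, R k.+1 zs ->
    (forall x, exists y, R k ((x, y) :: zs)) /\
    (forall y, exists x, R k ((x, y) :: zs)).

Lemma game_equiv (R : nat -> seq (G * H) -> Prop) :
  back_and_forth R -> (forall k zs, R k zs -> partial_iso zs) ->
  forall k n (phi : formula n) (zs : n.-tuple (G * H)),
    qdepth phi <= k -> R k zs ->
    sat phi (map_tuple fst zs) <-> sat phi (map_tuple snd zs).
Proof.
move=> bfR isoR k n phi; elim: phi k => {n}
  [n i j|n i j|n p IHp|n p IHp q IHq|n p IHp q IHq|n p IHp q IHq|n p IHp|n p IHp]
  k zs /= dk Rk.
- have [E _] := isoR k zs Rk _ _ (mem_tnth i zs) (mem_tnth j zs).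
  by rewrite !tnth_map; split=> /eqP; [rewrite E | rewrite -E] => /eqP.
- have [_ E] := isoR k zs Rk _ _ (mem_tnth i zs) (mem_tnth j zs).
  by rewrite !tnth_map E.
- by rewrite (IHp k).
- by move: dk; rewrite geq_max => /andP[dp dq]; rewrite (IHp k) // (IHq k).
- by move: dk; rewrite geq_max => /andP[dp dq]; rewrite (IHp k) // (IHq k).
- by move: dk; rewrite geq_max => /andP[dp dq]; rewrite (IHp k) // (IHq k).
- case: k dk Rk => // k dk /bfR[forth back].
  have E1 x y : [tuple of x :: map_tuple fst zs] =
      map_tuple fst [tuple of (x, y) :: zs] by exact: val_inj.
  have E2 x y : [tuple of y :: map_tuple snd zs] =
      map_tuple snd [tuple of (x, y) :: zs] by exact: val_inj.
  split=> [[x]|[y]].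
    by have [y Ry] := forth x; exists y; rewrite (E2 x) -(IHp k) // -E1.
  by have [x Rx] := back y; exists x; rewrite (E1 _ y) (IHp k) // -E2.
- case: k dk Rk => // k dk /bfR[forth back].
  have E1 x y : [tuple of x :: map_tuple fst zs] =
      map_tuple fst [tuple of (x, y) :: zs] by exact: val_inj.
  have E2 x y : [tuple of y :: map_tuple snd zs] =
      map_tuple snd [tuple of (x, y) :: zs] by exact: val_inj.
  split=> all_p.
    by move=> y; have [x Rx] := back y; rewrite (E2 x) -(IHp k) // -E1.
  by move=> x; have [y Ry] := forth x; rewrite (E1 _ y) (IHp k) // -E2.
Qed.

End Game.

(** * A complete bipartite graph together with cliques *)

Section BipartiteCliques.
Variables N c : nat.

(** The blocks [inl _] are the two sides of K_(N,N), each [inr i] is a clique, and the second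
    component numbers the [N] vertices of a block. *)
Definition bc_adj : rel ((bool + 'I_c) * 'I_N)%type := fun u v =>
  match u.1, v.1 with
  | inl b, inl b' => b != b'
  | inr i, inr j => (i == j) && (u.2 != v.2)
  | _, _ => false
  end.

Lemma bc_adj_sym : symmetric bc_adj.
Proof.
by move=> [[b|i] a] [[b'|j] a']; rewrite /bc_adj //= eq_sym // (eq_sym a').
Qed.

Lemma bc_adj_irrefl : irreflexive bc_adj.
Proof. by move=> [[b|i] a]; rewrite /bc_adj /= !eqxx. Qed.

Definition bicliques : sgraph := SGraph bc_adj_sym bc_adj_irrefl.

Definition block (v : bicliques) : bool + 'I_c := v.1.

Lemma fresh_in_block (s : seq bicliques) t : size s < N ->
  exists2 v : bicliques, block v = t & v \notin s.
Proof.
move=> sN.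
have [a as_] : exists a, (t, a) \notin s.
  apply/existsP; rewrite -negb_forall; apply: contraL sN => /forallP ts.
  rewrite -leqNgt -[N]card_ord cardE -(size_map (pair t)).
  apply: uniq_leq_size => [|v /mapP[a _ ->]]; last exact: ts.
  by rewrite map_inj_uniq ?enum_uniq // => a b [].
by exists (t, a).
Qed.

Lemma bicliques_contains m : 1 < N -> m <= c ->
  contains_induced (path3_isolated m) bicliques.
Proof.
move=> N1 mc; pose a0 := Ordinal (ltnW N1); pose a1 := Ordinal N1.
pose f (v : path3_isolated m) : bicliques :=
  match v with
  | inl i => nth (inl false, a0) [:: (inl false, a0); (inl true, a0); (inl false, a1)] i
  | inr ij => (inr (widen_ord mc ij.1), a0)
  end.
apply: (@contains_induced_of_map _ _ f) => -[i|[i i0]] [j|[j j0]] uv.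
- have {}uv : i != j by apply: contraNneq uv => ->.
  by case: i j uv => [[|[|[|//]]] /= hi] [[|[|[|//]]] /= hj].
- by case: i uv => [[|[|[|//]]] /= hi].
- by case: j uv => [[|[|[|//]]] /= hi].
have {}uv : i != j.
  by apply: contraNneq uv => <-; rewrite (ord1 i0) (ord1 j0).
have wij : widen_ord mc i == widen_ord mc j = false by apply/negbTE.
rewrite {1}/adj /= /copies_adj /= (negPf uv) /= /coadj /= /bc_adj /= wij andbT.
by apply: contraFneq wij => -[] E; apply/eqP/val_inj.
Qed.

(** An induced path on three vertices cannot lie in a clique, so its first two vertices are on
    opposite sides of the bipartite part. Being adjacent to neither, the isolated vertices lie in
    cliques, and in different ones since they are pairwise non-adjacent. *)
Lemma bicliques_contains_bound m :
  contains_induced (path3_isolated m) bicliques -> m <= c.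
Proof.
move=> /contains_inducedP[f fI fM].
pose p i : path3_isolated m := inl (inord i : 'I_3).
pose q (i : 'I_m) : path3_isolated m := inr (i, ord0).
have a01 : adj (f (p 0)) (f (p 1)) by rewrite fM /= /path_adj !inordK.
have a12 : adj (f (p 1)) (f (p 2)) by rewrite fM /= /path_adj !inordK.
have a02 : ~~ adj (f (p 0)) (f (p 2)) by rewrite fM /= /path_adj !inordK.
have p02 : f (p 0) != f (p 2).
  by rewrite (inj_eq fI); apply/eqP => -[/(congr1 val)]; rewrite /= !inordK.
have [b f0 f1] : exists2 b, block (f (p 0)) = inl b & block (f (p 1)) = inl (~~ b).
  move: a01 a12 a02 p02; rewrite /block.
  case: (f (p 0)) (f (p 1)) (f (p 2)) => [[b|i] a] [[b'|i'] a'] [[b2|i2] a2] //=;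
    rewrite /bc_adj //=; first by move=> bb' _ _ _; exists b => //; case: b b' bb' => [] [].
  move=> /andP[/eqP-> _] /andP[/eqP-> _]; rewrite eqxx /= negbK => /eqP->.
  by rewrite eqxx.
have fq i : {j | block (f (q i)) = inr j}.
  have n0 : ~~ adj (f (p 0)) (f (q i)) by rewrite fM.
  have n1 : ~~ adj (f (p 1)) (f (q i)) by rewrite fM.
  move: f0 f1 n0 n1; rewrite /block.
  case: (f (p 0)) (f (p 1)) (f (q i)) => [k a] [k' a'] [[b2|j] a2] /= -> ->;
    last by exists j.
  by rewrite /bc_adj /= !negbK => /eqP-> /eqP; case: b2.
have gI : injective (fun i => sval (fq i)).
  move=> i j /= ij; apply/eqP/negPn/negP => nij.
  have nq : f (q i) != f (q j) by rewrite (inj_eq fI); apply: contraNneq nij => -[->].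
  have : ~~ adj (f (q i)) (f (q j)) by rewrite fM /= /copies_adj /= (negPf nij).
  have fi := svalP (fq i); have fj := svalP (fq j); rewrite ij in fi.
  move: (sval (fq j)) fi fj nq => l; rewrite /block.
  case: (f (q i)) (f (q j)) => [k a] [k' a'] /= -> ->.
  by rewrite /bc_adj /= xpair_eqE !eqxx /= => ->.
by have := leq_card _ gI; rewrite !card_ord.
Qed.

Lemma bicliques_nbr_block (u v x : bicliques) :
  adj u x -> adj v x -> block u = block v.
Proof.
rewrite /block; case: u v x => [[b|i] a] [[b'|i'] a'] [[b2|i2] a2] //=;
  rewrite /bc_adj //=; first by case: b b' b2 => [] [] [].
by move=> /andP[/eqP-> _] /andP[/eqP-> _].
Qed.

(** A vertex [u] of the bipartite part must lie opposite the free side [b], which supplies its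
    neighbour; for [u] in a clique, the clique does. *)
Lemma bicliques_fresh_nbr (s : seq bicliques) b u : size s < N ->
  inl b \notin map block s -> u \in s -> exists2 v, v \notin s & adj u v.
Proof.
move=> sN bs us; case ub : (block u) => [b'|i].
  have bb' : b' != b.
    by apply: contraNneq bs => <-; rewrite -ub map_f.
  have [v vb vs] := fresh_in_block (inl b) sN.
  by exists v => //; move: ub vb; rewrite /= /bc_adj /block => -> ->.
have [v vb vs] := fresh_in_block (inr i) sN.
exists v => //; have uv : u != v by apply: contraNneq vs => <-.
move: ub vb uv; rewrite /= /bc_adj /block.
by case: u v {us vs} => [k a] [k' a'] /= -> ->; rewrite xpair_eqE !eqxx.
Qed.

(** All neighbours of a vertex on side [~~ b] lie on side [b], which [s] avoids. *)
Lemma bicliques_fresh_nonnbr (s : seq bicliques) b : size s < N ->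
  inl b \notin map block s ->
  exists v, [/\ block v = inl (~~ b), v \notin s & forall u, u \in s -> adj u v = false].
Proof.
move=> sN bs; have [v vb vs] := fresh_in_block (inl (~~ b)) sN.
exists v; split=> // u us; apply/negbTE/negP => uv.
suff ub : block u = inl b by move: bs; rewrite -ub map_f.
move: vb uv; rewrite /= /bc_adj /block => ->.
by case: u.1 => // b'; case: b b' {bs} => [] [].
Qed.

End BipartiteCliques.

(** * Duplicator's strategy *)

Definition swap (A B : Type) (p : A * B) : B * A := (p.2, p.1).

Lemma swapK (A B : Type) : cancel (@swap A B) (@swap B A).
Proof. by case. Qed.

Definition side c (t : bool + 'I_c) : option bool :=
  if t is inl b then Some b else None.

Section Positions.
Variables N c c' : nat.
Implicit Types zs : seq (bicliques N c * bicliques N c').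

Definition block_iso zs : Prop :=
  (forall p, p \in zs -> side (block p.1) = side (block p.2)) /\
  (forall p q, p \in zs -> q \in zs -> (p.1 == q.1) = (p.2 == q.2) /\
     (block p.1 == block q.1) = (block p.2 == block q.2)).

(** The invariant with one round left: in each graph the chosen vertices are pairwise non-adjacent,
    and any new vertex is adjacent to at most one of them. *)
Definition distinct_blocks zs : Prop :=
  [/\ forall p q, p \in zs -> q \in zs -> block p.1 = block q.1 -> p = q,
      forall p q, p \in zs -> q \in zs -> block p.2 = block q.2 -> p = q,
      exists b, inl b \notin map (@block N c) (map fst zs) &
      exists b, inl b \notin map (@block N c') (map snd zs)].

Lemma block_iso_partial zs : block_iso zs -> partial_iso zs.
Proof.
move=> [sP eP] p q pzs qzs; have [E1 E2] := eP p q pzs qzs; split=> //.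
move: (sP p pzs) (sP q qzs) E1 E2; rewrite /= /bc_adj /block /side.
case: p q {pzs qzs} => [[[b|i] a] [[b'|i'] a']] [[[b2|j] a2] [[b3|j'] a3]] //=.
  by move=> [->] [->].
move=> _ _; rewrite !xpair_eqE.
have inrE d (k l : 'I_d) : (inr k == inr l :> bool + 'I_d) = (k == l) by [].
by rewrite !inrE => + E2; rewrite -E2; case: (i == j) => //= ->.
Qed.

Lemma partial_iso_cons zs x y : partial_iso zs ->
  (forall p, p \in zs -> (p.1 == x) = (p.2 == y) /\ adj p.1 x = adj p.2 y) ->
  partial_iso ((x, y) :: zs).
Proof.
move=> iso xy p q; rewrite !inE => /predU1P[->|pzs] /predU1P[->|qzs] /=.
- by rewrite !eqxx; have := adj_irrefl x; have := adj_irrefl y => /= -> ->.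
- have [E1 E2] := xy q qzs; rewrite eq_sym E1 eq_sym; split=> //.
  by rewrite (adj_sym q.1) (adj_sym q.2) in E2.
- exact: xy.
exact: iso.
Qed.

Lemma distinct_blocks_partial zs : distinct_blocks zs -> partial_iso zs.
Proof.
move=> [D1 D2 [b1 b1P] [b2 b2P]] p q pzs qzs; split.
  apply/eqP/eqP => E.
    by rewrite (D1 p q) // E.
  by rewrite (D2 p q) // E.
have nadj d (s : seq (bicliques N d)) b u v : inl b \notin map (@block N d) s ->
    u \in s -> v \in s -> adj u v -> block u = block v.
  move=> bs us vs; have := map_f (@block N d) us; have := map_f (@block N d) vs.
  rewrite /= /bc_adj /block; case: u v {us vs} => [[b'|i] a] [[b''|j] a'] //=.
    by case: b b' b'' bs => [] [] [] // /negPf->.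
  by move=> _ _ /andP[/eqP->].
have [->|pq] := eqVneq p q.
  by rewrite !adj_irrefl.
apply/idP/idP => A.
  by case/eqP: pq; apply: D1 => //; apply: nadj b1P _ _ A; apply: map_f.
by case/eqP: pq; apply: D2 => //; apply: nadj b2P _ _ A; apply: map_f.
Qed.

(** A new [x] has neighbours in one block only, hence at most one chosen neighbour. The free side in
    the second graph guarantees a fresh neighbour of its partner, or else a fresh vertex with no
    chosen neighbour. *)
Lemma distinct_blocks_forth zs x : size zs < N -> distinct_blocks zs ->
  exists y, partial_iso ((x, y) :: zs).
Proof.
move=> sN D; have iso := distinct_blocks_partial D.
have [D1 D2 _ [b bP]] := D.
have sN2 : size (map snd zs) < N by rewrite size_map.
have [xzs|xzs] := boolP (x \in map fst zs).
  have [p pzs xp] := mapP xzs.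
  exists p.2; apply: partial_iso_cons => // q qzs; rewrite xp.
  exact: iso.
have x1 p : p \in zs -> (p.1 == x) = false.
  by move=> pzs; apply: contraNF xzs => /eqP <-; rewrite map_f.
have y1 (y : bicliques N c') : y \notin map snd zs ->
    forall p, p \in zs -> (p.2 == y) = false.
  by move=> yzs p pzs; apply: contraNF yzs => /eqP <-; rewrite map_f.
have [/hasP[p pzs px]|/hasPn none] := boolP (has (fun p => adj p.1 x) zs).
  have [y yzs py] := bicliques_fresh_nbr sN2 bP (map_f snd pzs).
  exists y; apply: partial_iso_cons => // q qzs; rewrite x1 // y1 //; split=> //.
  apply/idP/idP => A.
    by rewrite (D1 q p) //; apply: bicliques_nbr_block A px.
  by rewrite (D2 q p) //; apply: bicliques_nbr_block A py.
have [y [_ yzs yN]] := bicliques_fresh_nonnbr sN2 bP.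
exists y; apply: partial_iso_cons => // p pzs; rewrite x1 // y1 //; split=> //.
by rewrite yN ?map_f //; apply/negbTE/none.
Qed.

(** Finding [y] reduces to finding its block [t]: an old [x] has its partner in [t], and a new [x]
    is answered by one of the [N] vertices of [t] not yet used. *)
Lemma block_iso_cons zs x t : size zs < N -> block_iso zs ->
  side (block x) = side t ->
  (forall p, p \in zs -> (block p.1 == block x) = (block p.2 == t)) ->
  exists y, block_iso ((x, y) :: zs).
Proof.
move=> sN [sP eP] sx xt.
suff [y yt xy] : exists2 y, block y = t &
    forall p, p \in zs -> (p.1 == x) = (p.2 == y).
  exists y; split=> [p|p q]; rewrite !inE.
    by case/predU1P=> [->|/sP] //=; rewrite yt.
  move=> /predU1P[->|pzs] /predU1P[->|qzs] /=; first by rewrite !eqxx.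
  - by rewrite eq_sym xy // eq_sym [block x == _]eq_sym xt // yt eq_sym.
  - by rewrite xy // xt // yt.
  exact: eP.
have [/mapP[p pzs xp]|xzs] := boolP (x \in map fst zs).
  exists p.2; first by have := xt p pzs; rewrite xp eqxx => /esym/eqP.
  by move=> q qzs; rewrite xp; have [] := eP q p qzs pzs.
have [|y yt yzs] := @fresh_in_block N c' (map snd zs) t; first by rewrite size_map.
exists y => // p pzs.
have -> : (p.1 == x) = false by apply: contraNF xzs => /eqP <-; rewrite map_f.
by apply/esym; apply: contraNF yzs => /eqP <-; rewrite map_f.
Qed.

Lemma block_iso_forth zs x : size zs < N -> block_iso zs ->
  (exists y, block_iso ((x, y) :: zs)) \/
  [/\ exists i, block x = inr i,
      forall p, p \in zs -> block p.1 != block x &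
      forall j, inr j \in map (@block N c') (map snd zs)].
Proof.
move=> sN iso; have [sP eP] := iso.
case xb : (block x) => [b|i].
  left; apply: (@block_iso_cons zs x (inl b)); rewrite ?xb // => p /sP.
  by case: (block p.1) (block p.2) => [?|?] [?|?] //= [->].
have [/mapP[p pzs xp]|xzs] := boolP (block x \in map (fun p => block p.1) zs).
  left; apply: (@block_iso_cons zs x (block p.2)) => //; rewrite xp ?sP // => q qzs.
  by have [] := eP q p qzs pzs.
have xN p : p \in zs -> block p.1 != block x.
  by move=> pzs; apply: contraNneq xzs => <-; apply: (map_f (fun p => block p.1)).
have [/forallP full|] := boolP [forall j, inr j \in map (@block N c') (map snd zs)].
  by right; split=> //; [exists i | rewrite -xb].
rewrite negb_forall => /existsP[j jN].
left; apply: (@block_iso_cons zs x (inr j)); rewrite ?xb // => p pzs.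
rewrite -xb (negPf (xN p pzs)); apply/esym; apply: contraNF jN => /eqP <-.
by rewrite !map_f.
Qed.

(** Used cliques correspond injectively, so Duplicator never runs out of cliques when Spoiler plays
    in the graph that has fewer. *)
Lemma block_iso_full zs : block_iso zs ->
  (forall j, inr j \in map (@block N c') (map snd zs)) -> c' <= c.
Proof.
move=> [sP eP] full.
have g j : {i | has (fun p => (block p.1 == inr i) && (block p.2 == inr j)) zs}.
  apply: sigW; have /mapP[y /mapP[p pzs ->] pj] := full j.
  have := sP p pzs; rewrite -pj; case pi : (block p.1) => [//|i] _.
  by exists i; apply/hasP; exists p => //; rewrite pi -pj !eqxx.
have gI : injective (fun j => sval (g j)).
  move=> j k /= jk; have := svalP (g j); have := svalP (g k); rewrite jk.
  move=> /hasP[p pzs /andP[/eqP p1 /eqP p2]] /hasP[q qzs /andP[/eqP q1 /eqP q2]].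
  have [_] := eP p q pzs qzs; rewrite p1 q1 p2 q2 eqxx => /esym/eqP[].
  by move=> ->.
by have := leq_card _ gI; rewrite !card_ord.
Qed.

End Positions.

Lemma partial_iso_swap (G H : sgraph) (zs : seq (G * H)) :
  partial_iso zs -> partial_iso (map (@swap _ _) zs).
Proof.
by move=> iso _ _ /mapP[p pzs ->] /mapP[q qzs ->]; have [-> ->] := iso p q pzs qzs.
Qed.

Lemma block_iso_swap N c c' (zs : seq (bicliques N c * bicliques N c')) :
  block_iso zs -> block_iso (map (@swap _ _) zs).
Proof.
move=> [sP eP]; split=> [_ /mapP[p pzs ->]|_ _ /mapP[p pzs ->] /mapP[q qzs ->]].
  by rewrite sP.
by have [-> ->] := eP p q pzs qzs.
Qed.

Lemma distinct_blocks_swap N c c' (zs : seq (bicliques N c * bicliques N c')) :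
  distinct_blocks zs -> distinct_blocks (map (@swap _ _) zs).
Proof.
have E1 : map fst (map (@swap _ _) zs) = map snd zs by rewrite -map_comp.
have E2 : map snd (map (@swap _ _) zs) = map fst zs by rewrite -map_comp.
move=> [D1 D2 b1 b2]; split; rewrite ?E1 ?E2 //.
  by move=> _ _ /mapP[p pzs ->] /mapP[q qzs ->] /D2->.
by move=> _ _ /mapP[p pzs ->] /mapP[q qzs ->] /D1->.
Qed.

Section Strategy.
Variables N c : nat.
Hypothesis cN : c.+1 < N.
Implicit Types zs : seq (bicliques N c.+1 * bicliques N c).

(** The clock [size zs + k = c.+2] ties the rounds left to the position: using up [c] cliques takes
    [c] moves, so after the move that finds none left at most one round remains. *)
Definition duplicator_wins k zs : Prop :=
  size zs + k = c.+2 /\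
  [\/ block_iso zs, k = 1 /\ distinct_blocks zs | k = 0 /\ partial_iso zs].

Lemma duplicator_wins_partial k zs : duplicator_wins k zs -> partial_iso zs.
Proof.
by move=> [_ [/block_iso_partial|[_ /distinct_blocks_partial]|[]]].
Qed.

(* A clique of the larger graph is entered when all cliques of the smaller one
   are in use: this can be answered on one side of the bipartite component. *)
Lemma new_clique_forth k zs x i : size zs + k.+1 = c.+2 -> block_iso zs ->
  block x = inr i -> (forall p, p \in zs -> block p.1 != block x) ->
  (forall j, inr j \in map (@block N c) (map snd zs)) ->
  exists y, duplicator_wins k ((x, y) :: zs).
Proof.
move=> szs iso xi xN full; have [sP eP] := iso.
set B := map (@block N c) (map snd zs) in full *.
have sB : size B = size zs by rewrite !size_map.
pose I := [seq inr j : bool + 'I_c | j <- enum 'I_c].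
have uI : uniq I by rewrite map_inj_uniq ?enum_uniq // => j l [].
have sI : size I = c by rewrite size_map size_enum_ord.
have IB : {subset I <= B} by move=> _ /mapP[j _ ->].
have cB : c <= size zs by have := uniq_leq_size uI IB; rewrite sI sB.
have sN : size (map snd zs) < N by rewrite size_map; lia.
(* [B] contains all [c] cliques and has at most [c.+1] entries, so it misses a side. *)
have [b bB] : exists b, inl b \notin B.
  apply/existsP; rewrite -negb_forall; apply/negP => /forallP bB.
  have : size [:: inl true, inl false & I] <= size B.
    apply: uniq_leq_size => [|t]; last first.
      by rewrite !inE => /or3P[/eqP->|/eqP->|/IB].
    by rewrite /= uI !inE !negb_or /= andbT; apply/andP; split; apply/negP => /mapP[].
  by rewrite /= sI sB; lia.
have [y [yb yzs yN]] := bicliques_fresh_nonnbr sN bB.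
exists y; split; first by rewrite /= addSnnS.
have [k0|k1] : k = 0 \/ k = 1 by lia.
  constructor 3; split=> //.
  apply: partial_iso_cons; first exact: block_iso_partial.
  move=> p pzs; rewrite yN ?map_f //.
  have -> : (p.1 == x) = false by apply: contraNF (xN p pzs) => /eqP->.
  have -> : (p.2 == y) = false by apply: contraNF yzs => /eqP <-; rewrite map_f.
  split=> //; move: xi (xN p pzs); rewrite /= /bc_adj /block => ->.
  by case: p.1.1 => // j ji; rewrite (negPf (ji : j != i)).
(* With [k = 1] exactly [c] moves were made, so [B] lists each clique once and contains no side. *)
have BI : size B <= size I by rewrite sB sI; lia.
have uB := leq_size_uniq uI IB BI.
have [_ IeB] := uniq_min_size uI IB BI.
have inB p : p \in zs -> exists j, block p.2 = inr j.
  move=> pzs; have : block p.2 \in I by rewrite IeB !map_f.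
  by case/mapP=> j _ ->; exists j.
have D2 p q : p \in zs -> q \in zs -> block p.2 = block q.2 -> p = q.
  move=> pzs qzs E.
  move: uB; rewrite /B -map_comp => /(uniqP (block y)) U.
  rewrite -(nth_index p pzs) -(nth_index p qzs); congr nth.
  apply: U; rewrite ?inE ?size_map ?index_mem //.
  by rewrite !(nth_map p) ?index_mem // !nth_index.
constructor 2; split=> //; split.
- move=> p q; rewrite !inE => /predU1P[->|pzs] /predU1P[->|qzs] //= E.
  + by have := xN q qzs; rewrite E eqxx.
  + by have := xN p pzs; rewrite E eqxx.
  by apply: D2 => //; apply/eqP; have [_ <-] := eP p q pzs qzs; apply/eqP.
- move=> p q; rewrite !inE => /predU1P[->|pzs] /predU1P[->|qzs] //=; rewrite ?yb.
  + by have [j ->] := inB q qzs.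
  + by have [j ->] := inB p pzs.
  exact: D2.
(* No side is used in the larger graph, so [true] is an arbitrary choice; in the smaller one [y]
   lies on side [~~ b], leaving [b] free. *)
- exists true; rewrite /= xi inE /=; apply/negP => /mapP[_ /mapP[p pzs ->] E].
  by have := sP p pzs; have [j ->] := inB p pzs; rewrite -E.
by exists b; rewrite /= yb inE negb_or bB andbT; case: (b).
Qed.

Lemma duplicator_wins_back_and_forth : back_and_forth duplicator_wins.
Proof.
move=> k zs [szs].
have sN : size zs < N by lia.
have sN' : size (map (@swap _ _) zs) < N by rewrite size_map.
have szs' x y : size ((x, y) :: zs) + k = c.+2 by rewrite /= addSnnS.
case=> [iso|[[k0] D]|[//]].
  split=> [x|y].
    have [[y iso']|[[i xi] xN full]] := block_iso_forth x sN iso.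
      by exists y; split=> //; constructor 1.
    exact: new_clique_forth xi xN full.
  have [[x iso']|[_ _ full]] := block_iso_forth y sN' (block_iso_swap iso).
    exists x; split=> //; constructor 1.
    by have := block_iso_swap iso'; rewrite /= mapK //; apply: swapK.
  by have := block_iso_full (block_iso_swap iso) full; rewrite ltnn.
split=> [x|y].
  have [y isoy] := distinct_blocks_forth x sN D.
  by exists y; split=> //; constructor 3.
have [x isox] := distinct_blocks_forth y sN' (distinct_blocks_swap D).
exists x; split=> //; constructor 3; split=> //.
by have := partial_iso_swap isox; rewrite /= mapK //; apply: swapK.
Qed.

Lemma bicliques_equiv (phi : sentence) : qdepth phi <= c.+2 ->
  models (bicliques N c.+1) phi <-> models (bicliques N c) phi.
Proof.
move=> dphi.
have R0 : duplicator_wins c.+2 [tuple of [::]].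
  by split=> //; constructor 1; split.
have := game_equiv duplicator_wins_back_and_forth duplicator_wins_partial dphi R0.
by rewrite (tuple0 (map_tuple fst _)) (tuple0 (map_tuple snd _)).
Qed.

End Strategy.

Theorem theorem2 (m : nat) (hm : 0 < m) :
  let F := dunion (path_graph 3) (copies m (complete_graph 1)) in
  is_D F (#|F| - 1).
Proof.
move=> F.
have -> : #|F| - 1 = m + 2.
  by rewrite card_sum card_prod !card_ord muln1; lia.
case: m hm @F => // m _ F.
have lower (phi : sentence) :
    expresses phi (contains_induced F) -> m.+1 + 2 <= qdepth phi.
  move=> phiF; rewrite leqNgt; apply/negP => dphi.
  (* After the case split there are [m.+1] isolated vertices; [m.+2] is the least block size that
     [cN] allows for [c = m]. *)
  have /bicliques_contains_bound : contains_induced F (bicliques m.+2 m).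
    apply/phiF/(bicliques_equiv (ltnSn _)); first by lia.
    exact/phiF/bicliques_contains.
  by rewrite ltnn.
split=> //; have [phi dphi phiP] := definable_extends_to_nontwins m 0.
have phiF : expresses phi (contains_induced F).
  by move=> G; rewrite /models phiP contains_path3_isolatedP.
(* [phi] is only known to have depth at most [m + 3]; the lower bound makes this an equality. *)
exists phi => //; apply/eqP; rewrite eqn_leq lower // andbT.
by rewrite addSnnS.
Qed.
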